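(* For any graph $E$, with $\mathcal{A}$ the set of all strongly connected components of $E$, partially ordered by: $X\leq Y$ iff there exists a path $u\in\operatorname{Path}(E)$ such that $s(u)\in Y$ and $r(u)\in X$, the following statements hold: (1) $G(E)=\bigcup_{X\in\mathcal{A}}J_X^0$; (2) $J_X^0$ is isomorphic to a subsemigroup of $\mathcal{B}_{Q_X}^0(G(E_X))$, for each $X\in\mathcal{A}$; (3) $J_X^0\cap J_Y^0=\{0\}$ for all distinct $X,Y\in\mathcal{A}$; (4) for $X,Y\in\mathcal{A}$, if $X\leq Y$ then $J_X^0\cdot J_Y^0\cup J_Y^0\cdot J_X^0\subseteq J_X^0$; (5) for $X,Y\in\mathcal{A}$, if $X\nleq Y$ and $Y\nleq X$ then $J_X^0\cdot J_Y^0\cup J_Y^0\cdot J_X^0\subseteq\{0\}$.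
   Context: Graphs and paths. A graph means a directed graph $E=(E^0,E^1,r,s)$: disjoint sets $E^0$ (vertices) and $E^1$ (edges) with functions $s,r:E^1\to E^0$ (source and range). A path of non-zero length is a finite sequence of edges $x=e_1\ldots e_n$ ($n\ge 1$) with $r(e_i)=s(e_{i+1})$ for $i<n$; put $s(x)=s(e_1)$, $r(x)=r(e_n)$, $|x|=n$. Each vertex $e$ is a path of length $0$ with $s(e)=r(e)=e$. $\operatorname{Path}(E)$ is the set of all paths. If $r(a)=s(b)$, then $ab$ is the concatenation (vertices act as identities). A path $x$ is a prefix of $y$ if $y=xz$ for some path $z$. Vertices $a,b$ are strongly connected if there are paths $u,v$ with $a=s(u)=r(v)$ and $b=s(v)=r(u)$; this is an equivalence relation on $E^0$ and its classes are the strongly connected components of $E$. For non-empty $X\subseteq E^0$ the induced subgraph $E_X$ has vertex set $X$, edge set $\{x\in E^1\mid s(x)\in X,\ r(x)\in X\}$, and restricted source and range functions. Graph inverse semigroup. $G(E)$ is the semigroup with zero $0$ generated by $E^0$, $E^1$ and $E^{-1}=\{e^{-1}\mid e\in E^1\}$ (disjoint from $E^0\cup E^1$) subject to, for $a,b\in E^0$, $e,f\in E^1$: (1) $a\cdot b=a$ if $a=b$ and $a\cdot b=0$ if $a\ne b$; (2) $s(e)\cdot e=e\cdot r(e)=e$; (3) $e^{-1}\cdot s(e)=r(e)\cdot e^{-1}=e^{-1}$; (4) $e^{-1}\cdot f=r(e)$ if $e=f$ and $e^{-1}\cdot f=0$ if $e\neq f$. Each non-zero element is uniquely of the form $uv^{-1}$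 with $u,v\in\operatorname{Path}(E)$, $r(u)=r(v)$, and $u_1v_1^{-1}\cdot u_2v_2^{-1}$ equals $u_1wv_2^{-1}$ if $u_2=v_1w$ for a path $w$, equals $u_1(v_2w)^{-1}$ if $v_1=u_2w$ for a path $w$, and equals $0$ otherwise. $\mathcal{J}$-classes. Green's relation $\mathcal{J}$ on a semigroup: $a\mathcal{J}b$ iff $a$ and $b$ generate the same principal two-sided ideal. Non-zero $\mathcal{J}$-classes of $G(E)$ correspond bijectively to strongly connected components of $E$: $J_X$ denotes the $\mathcal{J}$-class containing the strongly connected component $X\subseteq E^0$, i.e. $J_X=\{uv^{-1}\mid u,v\in\operatorname{Path}(E),\ r(u)=r(v)\in X\}$; $J_X^0=J_X\cup\{0\}$. For a strongly connected component $X$, $I_X=\{u\in\operatorname{Path}(E)\mid r(u)\in X\}$ and $Q_X=\{u\in I_X\mid r(v)\notin X\text{ for each non-trivial prefix } v\text{ of }u\}$, where a prefix $v$ of $u$ is non-trivial if $|v|>0$ and $v\neq u$. Brandt extension. For a semigroup $S$ with zero $0_S$ and a non-empty set $X$, $\mathcal{B}_X(S)=X\times S\times X\sqcup\{0\}$ with $(a,s,b)\cdot(c,t,d)=(a,st,d)$ if $b=c$ and $0$ if $b\ne c$, and all products involving $0$ equal to $0$. The Brandt $X^0$-extension $\mathcal{B}_X^0(S)$ is the Rees factor semigroup of $\mathcal{B}_X(S)$ by the ideal $\{(a,0_S,b)\mid a,b\in X\}\cup\{0\}$. For subsets $P,Q$ of a semigroup, $P\cdot Q=\{pq\mid p\in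 P,\ q\in Q\}$.
   Formalization: Statement (1) is asserted only for graphs with at least one vertex: for the graph with no vertices G(E)={0} while the union over the empty set of components is empty, so (1) fails there; (2)-(5) are stated for every graph. *)

(* Defs.v *)
(* Semigroups are MathComp's [semigroupType]; the choice structure this requires
   is obtained classically on every carrier below. *)
From HB Require Import structures.
From mathcomp Require Import all_boot.
From mathcomp Require Import boolp classical_sets functions.

Set Implicit Arguments.
Unset Strict Implicit.
Unset Printing Implicit Defensive.

Local Open Scope classical_set_scope.
Local Open Scope group_scope.
Local Open Scope quotient_scope.

HB.mixin Record Semigroup_hasZero S of Semigroup S := {
  szero : S;
  mul0s : left_zero szero (@mul S);
  muls0 : right_zero szero (@mul S)
}.

#[short(type="semigroup0Type")]
HB.structure Definition Semigroup0 := {S of Semigroup_hasZero S & Semigroup S}.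

Arguments szero {s}.

Definition set_mul (S : semigroupType) (P Q : set S) : set S :=
  [set p * q | p in P & q in Q].

Definition subsemigroup (S : semigroupType) (A : set S) : Prop :=
  A !=set0 /\ set_mul A A `<=` A.

(* An isomorphism between two subsemigroups is given by a map defined on the
   whole of [S]; only its restriction to [A] is relevant. *)
Definition subsemigroup_isom (S S' : semigroupType) (A : set S) (B : set S') :
  Prop :=
  [/\ subsemigroup A, subsemigroup B &
    exists2 f : S -> S', set_bij A B f & {in A &, {morph f : x y / x * y}}].

Definition isom_to_subsemigroup (S S' : semigroupType) (A : set S) : Prop :=
  exists B : set S', subsemigroup_isom A B.

Definition two_sided_ideal (S : semigroupType) (I : set S) : Prop :=
  [/\ I !=set0, set_mul [set: S] I `<=` I & set_mul I [set: S] `<=` I].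

Definition principal_ideal (S : semigroupType) (a : S) : set S :=
  smallest (@two_sided_ideal S) [set a].

Definition greenJ (S : semigroupType) (a b : S) : Prop :=
  principal_ideal a = principal_ideal b.

Record ideal (S : semigroupType) := Ideal {
  ideal_set : set S;
  idealP : two_sided_ideal ideal_set
}.

Section ReesFactor.
Variables (S : semigroupType) (I : ideal S).

Definition rees_rel (x y : S) : Prop := x = y \/ (ideal_set I x /\ ideal_set I y).

Lemma rees_rel_refl : reflexive (fun x y => `[< rees_rel x y >]).
Proof. by move=> x; apply/asboolP; left. Qed.

Lemma rees_rel_sym : symmetric (fun x y => `[< rees_rel x y >]).
Proof.
by move=> x y; apply/asboolP/asboolP => -[->|[? ?]]; [left|right|left|right].
Qed.

Lemma rees_rel_trans : transitive (fun x y => `[< rees_rel x y >]).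
Proof.
move=> y x z /asboolP xy /asboolP yz; apply/asboolP.
case: xy yz => [->//|[Ix Iy]] [<-|[_ Iz]]; by right.
Qed.

Definition rees_equiv : equiv_rel S :=
  EquivRel (fun x y => `[< rees_rel x y >])
    rees_rel_refl rees_rel_sym rees_rel_trans.

Definition rees : Type := {eq_quot rees_equiv}.
HB.instance Definition _ : EqQuotient S rees_equiv rees := EqQuotient.on rees.
HB.instance Definition _ := Choice.on rees.

Lemma pi_reesP (x y : S) : \pi_rees x = \pi_rees y <-> rees_rel x y.
Proof.
by split=> [/eqmodP/asboolP|?]; last by apply/eqmodP/asboolP.
Qed.

Definition rees_mul (x y : rees) : rees := \pi_rees (repr x * repr y).

Lemma rees_mulE (x y : S) :
  rees_mul (\pi_rees x) (\pi_rees y) = \pi_rees (x * y).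
Proof.
have [_ Il Ir] := idealP I.
have IMl a b : ideal_set I b -> ideal_set I (a * b).
  by move=> Ib; apply: Il; exists a => //; exists b.
have IMr a b : ideal_set I a -> ideal_set I (a * b).
  by move=> Ia; apply: Ir; exists a => //; exists b.
apply/pi_reesP.
have /pi_reesP := reprK (\pi_rees x); have /pi_reesP := reprK (\pi_rees y).
case=> [->|[Iy' Iy]] [->|[Ix' Ix]].
- by left.
- by right; split; apply: IMr.
- by right; split; apply: IMl.
- by right; split; apply: IMl.
Qed.

Lemma rees_mulA : associative rees_mul.
Proof.
elim/quotW=> x; elim/quotW=> y; elim/quotW=> z.
by rewrite (rees_mulE x y) (rees_mulE y z) (rees_mulE x) (rees_mulE _ z) mulgA.
Qed.

HB.instance Definition _ := isSemigroup.Build rees rees_mulA.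

End ReesFactor.

Inductive brandt (X : Type) (S : semigroup0Type) : Type :=
| BrandtZero
| BrandtTriple of X & S & X.

Arguments BrandtZero {X S}.

Section Brandt.
Variables (X : Type) (S : semigroup0Type).
Local Notation B := (brandt X S).

HB.instance Definition _ := gen_eqMixin B.
HB.instance Definition _ := gen_choiceMixin B.

Definition brandt_mul (x y : B) : B :=
  match x, y with
  | BrandtTriple a s b, BrandtTriple c t d =>
      if `[< b = c >] then BrandtTriple a (s * t) d else BrandtZero
  | _, _ => BrandtZero
  end.

Lemma brandt_mulA : associative brandt_mul.
Proof.
move=> [|a s b] [|c t d] [|e u f] //=; try by case: `[< _ >].
by case: asboolP => de /=; case: asboolP => bc //=; rewrite ?mulgA;
  [rewrite asboolT|rewrite asboolF].
Qed.

HB.instance Definition _ := isSemigroup.Build B brandt_mulA.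

Definition brandt_zeros : set B :=
  [set x | x = BrandtZero \/ exists a b, x = BrandtTriple a szero b].

Lemma brandt_zeros_ideal : two_sided_ideal brandt_zeros.
Proof.
split; first by exists BrandtZero; left.
- move=> _ [x _ [y [->|[a [b ->]]]] <-]; first by left; case: x.
  case: x => [|c s d]; first by left.
  rewrite /mul/=; case: asboolP => _; last by left.
  by right; exists c, b; rewrite muls0.
- move=> _ [x [->|[a [b ->]]] [y _] <-]; first by left.
  case: y => [|c s d]; first by left.
  rewrite /mul/=; case: asboolP => _; last by left.
  by right; exists a, d; rewrite mul0s.
Qed.

Definition brandt0 : Type := rees (Ideal brandt_zeros_ideal).
HB.instance Definition _ := Semigroup.on brandt0.

End Brandt.

(* Directed graphs; the disjointness of vertices, edges and formal inverses of
   edges is provided by the typing. *)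
Record graph := Graph {
  vertex : Type;
  edge : Type;
  esrc : edge -> vertex;
  erng : edge -> vertex
}.

Section Paths.
Variable E : graph.
Implicit Types (a b : vertex E) (e f : edge E).

Fixpoint walk (a : vertex E) (es : seq (edge E)) : Prop :=
  if es is e :: es' then esrc e = a /\ walk (erng e) es' else True.

Definition walk_end (a : vertex E) (es : seq (edge E)) : vertex E :=
  last a (map (@erng E) es).

(* A path is stored with its source, so that the paths without edges are
   exactly the vertices. For a non-empty sequence of edges [walk] forces the
   source to be that of the first edge. *)
Record path := Path {
  psrc : vertex E;
  pedges : seq (edge E);
  pwalk : walk psrc pedges
}.

Definition prng (u : path) : vertex E := walk_end (psrc u) (pedges u).

Definition plen (u : path) : nat := size (pedges u).

Definition pvertex (a : vertex E) : path := @Path a [::] I.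

Lemma walk_cat a (es fs : seq (edge E)) :
  walk a es -> walk (walk_end a es) fs -> walk a (es ++ fs).
Proof. by elim: es a => //= e es IH a [-> wes] wfs; split=> //; apply: IH. Qed.

Lemma pcat_walk (u v : path) :
  prng u = psrc v -> walk (psrc u) (pedges u ++ pedges v).
Proof.
move=> uv; apply: walk_cat; first exact: pwalk.
by rewrite -/(prng u) uv; apply: pwalk.
Qed.

Definition pcat (u v : path) (uv : prng u = psrc v) : path :=
  Path (pcat_walk uv).

Lemma prng_cat (u v : path) (uv : prng u = psrc v) : prng (pcat uv) = prng v.
Proof.
by rewrite /prng /walk_end /= map_cat last_cat [X in last X _]uv.
Qed.

Definition prefix (x y : path) : Prop :=
  exists (z : path) (xz : prng x = psrc z), y = pcat xz.

Definition strongly_connected (a b : vertex E) : Prop :=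
  exists u v : path, [/\ a = psrc u, a = prng v, b = psrc v & b = prng u].

Definition components : set (set (vertex E)) :=
  [set X | exists a, X = [set b | strongly_connected a b]].

Definition comp_le (X Y : set (vertex E)) : Prop :=
  exists u : path, Y (psrc u) /\ X (prng u).

Lemma strongly_connected_refl a : strongly_connected a a.
Proof. by exists (pvertex a), (pvertex a). Qed.

Lemma strongly_connected_sym a b :
  strongly_connected a b -> strongly_connected b a.
Proof. by case=> u [v [? ? ? ?]]; exists v, u. Qed.

Lemma strongly_connected_trans a b c :
  strongly_connected a b -> strongly_connected b c -> strongly_connected a c.
Proof.
move=> [u [v [au av bv bu]]] [u' [v' [bu' bv' cv' cu']]].
have uu' : prng u = psrc u' by rewrite -bu.
have vv' : prng v' = psrc v by rewrite -bv'.
by exists (pcat uu'), (pcat vv'); split; rewrite ?prng_cat.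
Qed.

Lemma components_path X a b :
  components X -> X a -> X b -> exists u, psrc u = a /\ prng u = b.
Proof.
move=> [c ->] /strongly_connected_sym ac cb.
have [u [v [? _ _ ?]]] := strongly_connected_trans ac cb.
by exists u.
Qed.

Lemma comp_le_refl X : components X -> comp_le X X.
Proof. by case=> a ->; exists (pvertex a); split; apply: strongly_connected_refl. Qed.

Lemma comp_le_trans X Y Z : components Y ->
  comp_le X Y -> comp_le Y Z -> comp_le X Z.
Proof.
move=> cY [u [Yu Xu]] [v [Zv Yv]].
have [w [wv wu]] := components_path cY Yv Yu.
have vw : prng v = psrc w by [].
have vwu : prng (pcat vw) = psrc u by rewrite prng_cat.
by exists (pcat vwu); rewrite prng_cat.
Qed.

Lemma comp_le_anti X Y : components X -> components Y ->
  comp_le X Y -> comp_le Y X -> X = Y.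
Proof.
move=> cX cY [u [Yu Xu]] [v [Xv Yv]].
have [w [wu wv]] := components_path cX Xu Xv.
have [w' [w'v w'u]] := components_path cY Yv Yu.
have uw : prng u = psrc w by [].
have uwv : prng (pcat uw) = psrc v by rewrite prng_cat.
have sc : strongly_connected (prng u) (psrc u).
  have wv' : prng w = psrc v by [].
  have wvw : prng (pcat wv') = psrc w' by rewrite prng_cat.
  by exists (pcat wvw), u; split; rewrite ?prng_cat.
case: cX Xu => a -> au; case: cY Yu => b -> bu.
have ab := strongly_connected_trans (strongly_connected_trans au sc)
  (strongly_connected_sym bu).
apply/seteqP; split=> c /= h.
  exact: strongly_connected_trans (strongly_connected_sym ab) h.
exact: strongly_connected_trans ab h.
Qed.

End Paths.

Arguments components : clear implicits.

Definition induced_subgraph (E : graph) (X : set (vertex E)) : graph :=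
  @Graph (set_type X)
    (set_type [set e : edge E | X (esrc e) /\ X (erng e)])
    (fun e => SigSub (mem_set (set_mem (valP e)).1))
    (fun e => SigSub (mem_set (set_mem (valP e)).2)).

(* The semigroup with zero presented by generators and relations: terms over
   the generators modulo the least congruence containing the semigroup laws,
   the zero laws and the defining relations. *)
Section GraphInverseSemigroup.
Variable E : graph.

Inductive gterm : Type :=
| GZero
| GVertex of vertex E
| GEdge of edge E
| GInv of edge E
| GMul of gterm & gterm.

Inductive geq : gterm -> gterm -> Prop :=
| geq_refl x : geq x x
| geq_sym x y : geq x y -> geq y x
| geq_trans x y z : geq x y -> geq y z -> geq x z
| geq_mul x x' y y' : geq x x' -> geq y y' -> geq (GMul x y) (GMul x' y')
| geq_assoc x y z : geq (GMul x (GMul y z)) (GMul (GMul x y) z)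
| geq_mul0 x : geq (GMul GZero x) GZero
| geq_0mul x : geq (GMul x GZero) GZero
| geq_vv a : geq (GMul (GVertex a) (GVertex a)) (GVertex a)
| geq_vv0 a b : a <> b -> geq (GMul (GVertex a) (GVertex b)) GZero
| geq_se e : geq (GMul (GVertex (esrc e)) (GEdge e)) (GEdge e)
| geq_er e : geq (GMul (GEdge e) (GVertex (erng e))) (GEdge e)
| geq_is e : geq (GMul (GInv e) (GVertex (esrc e))) (GInv e)
| geq_ri e : geq (GMul (GVertex (erng e)) (GInv e)) (GInv e)
| geq_ie e : geq (GMul (GInv e) (GEdge e)) (GVertex (erng e))
| geq_ie0 e f : e <> f -> geq (GMul (GInv e) (GEdge f)) GZero.

HB.instance Definition _ := gen_eqMixin gterm.
HB.instance Definition _ := gen_choiceMixin gterm.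

Lemma geq_brefl : reflexive (fun x y => `[< geq x y >]).
Proof. by move=> x; apply/asboolP/geq_refl. Qed.

Lemma geq_bsym : symmetric (fun x y => `[< geq x y >]).
Proof. by move=> x y; apply/asboolP/asboolP; apply: geq_sym. Qed.

Lemma geq_btrans : transitive (fun x y => `[< geq x y >]).
Proof.
by move=> y x z /asboolP xy /asboolP yz; apply/asboolP; apply: geq_trans yz.
Qed.

Definition geq_equiv : equiv_rel gterm :=
  EquivRel (fun x y => `[< geq x y >]) geq_brefl geq_bsym geq_btrans.

Definition gis : Type := {eq_quot geq_equiv}.
HB.instance Definition _ : EqQuotient gterm geq_equiv gis := EqQuotient.on gis.
HB.instance Definition _ := Choice.on gis.

Lemma pi_gisP (x y : gterm) : \pi_gis x = \pi_gis y <-> geq x y.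
Proof.
by split=> [/eqmodP/asboolP|?]; last by apply/eqmodP/asboolP.
Qed.

Definition gis_mul (x y : gis) : gis := \pi_gis (GMul (repr x) (repr y)).

Lemma gis_mulE (x y : gterm) :
  gis_mul (\pi_gis x) (\pi_gis y) = \pi_gis (GMul x y).
Proof. by apply/pi_gisP; apply: geq_mul; apply/pi_gisP; rewrite reprK. Qed.

Lemma gis_mulA : associative gis_mul.
Proof.
elim/quotW=> x; elim/quotW=> y; elim/quotW=> z; 
rewrite (gis_mulE x y) (gis_mulE y z) (gis_mulE x) (gis_mulE _ z).
by apply/pi_gisP/geq_assoc.
Qed.

HB.instance Definition _ := isSemigroup.Build gis gis_mulA.

Lemma gis_mul0 : left_zero (\pi_gis GZero) (@mul gis).
Proof. by elim/quotW=> x; rewrite /mul/= gis_mulE; apply/pi_gisP/geq_mul0. Qed.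

Lemma gis_0mul : right_zero (\pi_gis GZero) (@mul gis).
Proof. by elim/quotW=> x; rewrite /mul/= gis_mulE; apply/pi_gisP/geq_0mul. Qed.

HB.instance Definition _ := Semigroup_hasZero.Build gis gis_mul0 gis_0mul.

Definition gvertex (a : vertex E) : gis := \pi_gis (GVertex a).

End GraphInverseSemigroup.

Section JClasses.
Variable E : graph.
Variable X : set (vertex E).

(* When [X] is a strongly connected component its vertices are pairwise
   J-equivalent, so this is a single J-class, the one containing [X]. *)
Definition Jclass : set (gis E) :=
  [set g | exists2 a, X a & greenJ g (gvertex a)].

Definition Jclass0 : set (gis E) := Jclass `|` [set szero].

Definition I_paths : set (path E) := [set u | X (prng u)].

Definition Q_paths : set (path E) :=
  [set u | I_paths u /\
    forall v, prefix v u -> (0 < plen v)%N -> v <> u -> ~ X (prng v)].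

End JClasses.

(* Main.v *)
Require Import Defs.
From HB Require Import structures.
From mathcomp Require Import all_boot.
From mathcomp Require Import boolp classical_sets functions.

(** The whole proof is carried by the normal forms [u v^-1] of the elements of
    [G(E)], where [u] and [v] are paths ending at the same vertex [c].

    The product of [u1 v1^-1], with end vertex [c], and [u2 v2^-1], with end
    vertex [d], is non-zero only if one of [v1], [u2] is a prefix of the other;
    the product is then in normal form, its end vertex is [c] or [d], and the
    remainder of the longer path leads from the other one of these two vertices
    to it ([standard_mul]). Since [u v^-1] generates the same ideal as its end
    vertex, and since two vertices generating the same ideal are strongly
    connected, [J_X] consists of the normal forms whose end vertex is in [X]
    ([JclassP]). The covering of [G(E)], the disjointness of the classes and
    the position of their products follow from these two facts and the
    antisymmetry of the order on components.

    As [G(E)] is given by a presentation, proving that two elements differ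
    requires a model. Here it is an action by partial injections on finite
    walks: an edge is put in front of a walk, its inverse removes it. The
    element [u v^-1] replaces the prefix [v] by [u], so that the pair [(u, v)]
    is recovered from the shortest walk on which the action is defined: the
    action is faithful ([gact_faithful]).

    For the embedding of [J_X], a path ending in [X] is cut at the first vertex
    of [X] that it meets. The first half [p] is in [Q_X], and the second half
    stays in [X] because [X] is strongly connected, so that it is a path of
    [E_X]. Hence an element of [J_X] has the form [p g q^-1] where [g] is the
    image of an element of [G(E_X)]. Two distinct paths meeting [X] only at
    their end are not prefixes of each other, whence [q^-1 p' = 0] if [q] and
    [p'] differ: the elements [p g q^-1] multiply as the triples [(p, g, q)] of
    the Brandt extension ([assembleM]). The triple is unique when the product
    is not zero, because [p^-1 (p g q^-1) q = g] and because [G(E_X)] embeds in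
    [G(E)] ([gincl_inj], by faithfulness of the action). The triples with [g =
    0] are exactly those identified with zero in the Rees quotient. *)

Local Open Scope classical_set_scope.

Set Implicit Arguments.
Unset Strict Implicit.
Unset Printing Implicit Defensive.

Local Open Scope group_scope.
Local Open Scope quotient_scope.

(** * Generators and normal forms *)

Section Generators.
Variable E : graph.
Implicit Types (a b : vertex E) (e f : edge E) (g h : gis E).

Definition gedge e : gis E := \pi_(gis E) (GEdge e).
Definition gedgeV e : gis E := \pi_(gis E) (GInv e).

Lemma gmulE (s t : gterm E) :
  (\pi_(gis E) s : gis E) * (\pi_(gis E) t) = \pi_(gis E) (GMul s t).
Proof. exact: gis_mulE. Qed.

Lemma gvertexM a : gvertex a * gvertex a = gvertex a.
Proof. by rewrite gmulE; apply/pi_gisP/geq_vv. Qed.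

Lemma gvertexM0 a b : a <> b -> gvertex a * gvertex b = szero.
Proof. by move=> ab; rewrite gmulE; apply/pi_gisP/geq_vv0. Qed.

Lemma gvertex_edge e : gvertex (esrc e) * gedge e = gedge e.
Proof. by rewrite gmulE; apply/pi_gisP/geq_se. Qed.

Lemma gedge_vertex e : gedge e * gvertex (erng e) = gedge e.
Proof. by rewrite gmulE; apply/pi_gisP/geq_er. Qed.

Lemma gedgeV_vertex e : gedgeV e * gvertex (esrc e) = gedgeV e.
Proof. by rewrite gmulE; apply/pi_gisP/geq_is. Qed.

Lemma gvertex_edgeV e : gvertex (erng e) * gedgeV e = gedgeV e.
Proof. by rewrite gmulE; apply/pi_gisP/geq_ri. Qed.

Lemma gedgeVM e : gedgeV e * gedge e = gvertex (erng e).
Proof. by rewrite gmulE; apply/pi_gisP/geq_ie. Qed.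

Lemma gedgeVM0 e f : e <> f -> gedgeV e * gedge f = szero.
Proof. by move=> ef; rewrite gmulE; apply/pi_gisP/geq_ie0. Qed.

Lemma gis_ind (P : gis E -> Prop) :
  P szero -> (forall a, P (gvertex a)) -> (forall e, P (gedge e)) ->
  (forall e, P (gedgeV e)) -> (forall g h, P g -> P h -> P (g * h)) ->
  forall g, P g.
Proof.
move=> P0 Pv Pe Pi PM; elim/quotW; elim=> [|a|e|e|s Ps t Pt];
  [exact: P0|exact: Pv|exact: Pe|exact: Pi|].
by have := PM _ _ Ps Pt; rewrite gmulE.
Qed.

End Generators.

Section Paths.
Variable E : graph.
Implicit Types (a b c d : vertex E) (e f : edge E) (g h : gis E).
Implicit Types (u v w : Defs.path E) (es fs : seq (edge E)).

Lemma path_ext u v : psrc u = psrc v -> pedges u = pedges v -> u = v.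
Proof.
case: u v => a es wa [b fs wb] /= ab ef; case: _ / ab wb; case: _ / ef => wb.
by rewrite (Prop_irrelevance wa wb).
Qed.

Lemma prefixI u v es :
  psrc u = psrc v -> pedges v = pedges u ++ es -> Defs.prefix u v.
Proof.
move=> suv euv.
have wes : walk (prng u) es.
  have := pwalk v; rewrite -suv euv /prng /walk_end.
  by elim: (pedges u) (psrc u) => //= e s IH a [_ /IH].
by exists (Path wes), erefl; apply: path_ext.
Qed.

(** The products along a walk and along its inverse are defined on raw walks, as
    this allows induction on the edges; [gpath] and [gpathV] are their bundled
    versions. *)
Fixpoint gwalk a es : gis E :=
  if es is e :: es' then gedge e * gwalk (erng e) es' else gvertex a.

Fixpoint gwalkV a es : gis E :=
  if es is e :: es' then gwalkV (erng e) es' * gedgeV e else gvertex a.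

Definition gpath u : gis E := gwalk (psrc u) (pedges u).
Definition gpathV u : gis E := gwalkV (psrc u) (pedges u).

Lemma gvertex_walk a es : walk a es -> gvertex a * gwalk a es = gwalk a es.
Proof.
case: es => [|e es] /= => [_|[<- _]]; rewrite ?gvertexM //.
by rewrite mulgA gvertex_edge.
Qed.

Lemma gwalkV_vertex a es : walk a es -> gwalkV a es * gvertex a = gwalkV a es.
Proof.
case: es => [|e es] /= => [_|[<- _]]; rewrite ?gvertexM //.
by rewrite -mulgA gedgeV_vertex.
Qed.

Lemma gwalk_vertex a es : gwalk a es * gvertex (walk_end a es) = gwalk a es.
Proof.
by elim: es a => [|e es IH] a /=; rewrite ?gvertexM // -mulgA (IH (erng e)).
Qed.

Lemma gvertex_walkV a es : gvertex (walk_end a es) * gwalkV a es = gwalkV a es.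
Proof.
by elim: es a => [|e es IH] a /=; rewrite ?gvertexM // mulgA (IH (erng e)).
Qed.

Lemma gwalkVM a es : walk a es ->
  gwalkV a es * gwalk a es = gvertex (walk_end a es).
Proof.
elim: es a => [|e es IH] a /=; first by rewrite gvertexM.
move=> [_ wes]; rewrite mulgA -(mulgA _ (gedgeV e)) gedgeVM gwalkV_vertex //.
exact: IH.
Qed.

Lemma gwalk_cat a es fs : walk (walk_end a es) fs ->
  gwalk a (es ++ fs) = gwalk a es * gwalk (walk_end a es) fs.
Proof.
elim: es a => [|e es IH] a /=; first by move=> wfs; rewrite gvertex_walk.
by move=> /(IH (erng e)) ->; rewrite mulgA.
Qed.

Lemma gwalkV_cat a es fs : walk (walk_end a es) fs ->
  gwalkV a (es ++ fs) = gwalkV (walk_end a es) fs * gwalkV a es.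
Proof.
elim: es a => [|e es IH] a /=; first by move=> wfs; rewrite gwalkV_vertex.
by move=> /(IH (erng e)) ->; rewrite mulgA.
Qed.

(** Facing edges [e^-1 f] either cancel or kill the product, so that the
    cancellation goes on until one of the walks is exhausted. *)
Lemma gwalkVM_comparable a b es fs : walk a es -> walk b fs ->
  gwalkV a es * gwalk b fs <> szero ->
  a = b /\ exists r, fs = es ++ r \/ es = fs ++ r.
Proof.
elim: es a b fs => [|e es IH] a b [|f fs] /=.
- move=> _ _ n0; split; last by exists [::]; left.
  by apply: contrapT => /gvertexM0.
- move=> _ [<- _]; rewrite -gvertex_edge mulgA (mulgA (gvertex a)) => n0.
  split; last by exists (f :: fs); left.
  by apply: contrapT => /gvertexM0 e0; apply: n0; rewrite e0 !mul0s.
- move=> [<- _] _; rewrite -gedgeV_vertex -mulgA -(mulgA (gedgeV e)) => n0.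
  split; last by exists (e :: es); right.
  by apply: contrapT => /gvertexM0 e0; apply: n0; rewrite e0 !muls0.
- move=> [<- wes] [<- wfs]; rewrite mulgA -(mulgA _ (gedgeV e)) => n0.
  have ef : e = f.
    by apply: contrapT => /gedgeVM0 e0; apply: n0; rewrite e0 muls0 mul0s.
  subst f; rewrite gedgeVM gwalkV_vertex // in n0.
  split=> //; have [_ [r [->|->]]] := IH _ _ _ wes wfs n0; exists r;
    by [left|right].
Qed.

Lemma gpath_end u : gpath u * gvertex (prng u) = gpath u.
Proof. exact: gwalk_vertex. Qed.

Lemma gpathV_end u : gvertex (prng u) * gpathV u = gpathV u.
Proof. exact: gvertex_walkV. Qed.

Lemma gpathVM u : gpathV u * gpath u = gvertex (prng u).
Proof. exact/gwalkVM/pwalk. Qed.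

Lemma gpath_cat u v (uv : prng u = psrc v) :
  gpath (pcat uv) = gpath u * gpath v.
Proof.
rewrite /gpath /= gwalk_cat -/(prng u) uv //; exact: pwalk.
Qed.

Lemma gpathV_cat u v (uv : prng u = psrc v) :
  gpathV (pcat uv) = gpathV v * gpathV u.
Proof.
rewrite /gpathV /= gwalkV_cat -/(prng u) uv //; exact: pwalk.
Qed.

Lemma gpathVM_comparable u v : gpathV u * gpath v <> szero ->
  Defs.prefix u v \/ Defs.prefix v u.
Proof.
move=> /(gwalkVM_comparable (pwalk u) (pwalk v)) [suv [r [|]]] euv.
  by left; apply: prefixI euv.
by right; apply: prefixI euv.
Qed.

Definition standard_at c : set (gis E) :=
  [set g | exists u v, [/\ prng u = c, prng v = c & g = gpath u * gpathV v]].

Lemma standard_path u : standard_at (prng u) (gpath u).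
Proof.
by exists u, (pvertex (prng u)); split=> //; rewrite [gpathV _]/= gpath_end.
Qed.

Lemma standard_pathV u : standard_at (prng u) (gpathV u).
Proof.
by exists (pvertex (prng u)), u; split=> //; rewrite [gpath _]/= gpathV_end.
Qed.

Definition path_edge e : Defs.path E := @Path E (esrc e) [:: e] (conj erefl I).

Lemma standard_vertex a : standard_at a (gvertex a).
Proof. exact: (standard_path (pvertex a)). Qed.

Lemma standard_edge e : standard_at (erng e) (gedge e).
Proof.
have := standard_path (path_edge e).
by rewrite /gpath /= gedge_vertex.
Qed.

Lemma standard_edgeV e : standard_at (erng e) (gedgeV e).
Proof.
have := standard_pathV (path_edge e).
by rewrite /gpathV /= gvertex_edgeV.
Qed.

Definition reach a b := exists u, psrc u = a /\ prng u = b.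

Lemma reach_trans a b c : reach a b -> reach b c -> reach a c.
Proof.
move=> [u [<- ub]] [v [vb <-]]; have uv : prng u = psrc v by rewrite ub.
by exists (pcat uv); rewrite prng_cat.
Qed.

Lemma reach_sc a b : reach a b -> reach b a -> strongly_connected a b.
Proof. by move=> [u [? ?]] [v [? ?]]; exists u, v. Qed.

(** If [u2 = v1 w] the product is [(u1 w) v2^-1], and [w] leads from [c] to [d];
    the other case is symmetric. *)
Lemma standard_mul c d g h : standard_at c g -> standard_at d h ->
  g * h <> szero ->
  reach d c /\ standard_at c (g * h) \/ reach c d /\ standard_at d (g * h).
Proof.
move=> [u1 [v1 [u1c v1c ->]]] [u2 [v2 [u2d v2d ->]]].
rewrite mulgA -(mulgA (gpath u1)) => n0.
have /gpathVM_comparable : gpathV v1 * gpath u2 <> szero.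
  by move=> e0; apply: n0; rewrite e0 muls0 mul0s.
case=> -[w [zw E0]]; [right; subst u2|left; subst v1]; split.
- by exists w; rewrite -zw v1c -u2d prng_cat.
- have uw : prng u1 = psrc w by rewrite u1c -v1c.
  exists (pcat uw), v2; split; rewrite ?prng_cat // -?u2d ?prng_cat //.
  by rewrite !gpath_cat (mulgA (gpathV v1)) gpathVM v1c -u1c mulgA gpath_end.
- by exists w; rewrite -zw u2d -v1c prng_cat.
- have vw : prng v2 = psrc w by rewrite v2d -u2d.
  exists u1, (pcat vw); split; rewrite ?prng_cat // -?v1c ?prng_cat //.
  rewrite !gpathV_cat -(mulgA (gpathV w)) gpathVM u2d -v2d -!mulgA.
  by rewrite gpathV_end.
Qed.

Lemma standard_form g : g = szero \/ exists c, standard_at c g.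
Proof.
elim/gis_ind: g => [|a|e|e|g h]; first by left.
- by right; exists a; apply: standard_vertex.
- by right; exists (erng e); apply: standard_edge.
- by right; exists (erng e); apply: standard_edgeV.
move=> [->|[c cg]]; first by rewrite mul0s; left.
move=> [->|[d dh]]; first by rewrite muls0; left.
have [->|n0] := pselect (g * h = szero); first by left.
by right; case: (standard_mul cg dh n0) => -[_ ?]; [exists c|exists d].
Qed.

End Paths.

(** * The faithful action on finite walks *)

Section Action.
Variable E : graph.
Implicit Types (y z : vertex E * seq (edge E)).

(** The partial injection given by a term, as a relation from arguments [y] to
    values [z]. The pairs [y] are not required to be walks: the relations of the
    presentation only test the source and the first edge. *)
Fixpoint act (t : gterm E) y z : Prop :=
  match t with
  | GZero => False
  | GVertex a => y.1 = a /\ z = y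
  | GEdge e => y.1 = erng e /\ z = (esrc e, e :: y.2)
  | GInv e => z.1 = erng e /\ y = (esrc e, e :: z.2)
  | GMul s t => exists2 x, act t y x & act s x z
  end.

Lemma act_geq s t : Defs.geq s t -> forall y z, act s y z <-> act t y z.
Proof.
elim=> {s t} //=.
- by move=> s t _ IH y z; rewrite IH.
- by move=> s t r _ IH1 _ IH2 y z; rewrite IH1.
- by move=> s s' t t' _ IH1 _ IH2 y z; split=> -[x /IH2 ? /IH1 ?]; exists x.
- move=> r s t y z; split=> [[x [x']]|[x ? [x']]].
    by move=> ? ? ?; exists x' => //; exists x.
  by exists x' => //; exists x.
- by move=> s y z; split=> // -[].
- by move=> s y z; split=> // -[].
- by move=> a y z; split=> [[x [? ->] [? ->]]|[? ->]] //; exists y.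
- by move=> a b ab y z; split=> // -[x [yb ->] [/esym]]; rewrite yb.
- move=> e y z; split=> [[x [? ->] [? ->]]|[? ->]] //.
  by exists (esrc e, e :: y.2).
- by move=> e y z; split=> [[x [? ->] [? ->]]|[? ->]] //; exists y.
- move=> e y z; split=> [[x [? ->] [? ->]]|[? ->]] //.
  by exists (esrc e, e :: z.2).
- by move=> e y z; split=> [[x [? ->] [? ->]]|[? ->]] //; exists z.
- move=> e [b es] [c fs] /=; split=> [[x [-> ->] [-> [->]]]|[-> [-> ->]]] //.
  by exists (esrc e, e :: es).
- move=> e f ef y z; split=> // -[x [_ ->] [_ [_ fe]]]; by case: ef.
Qed.

Definition gact (g : gis E) := act (repr g).

Lemma gact_pi t y z : gact (\pi_(gis E) t) y z <-> act t y z.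
Proof. by apply: act_geq; apply/pi_gisP; rewrite reprK. Qed.

Lemma gactM g h y z :
  gact (g * h) y z <-> exists2 x, gact h y x & gact g x z.
Proof. by rewrite -[g]reprK -[h]reprK gmulE gact_pi /=; split=> -[x ? ?];
  exists x => //; apply/gact_pi. Qed.

Lemma gact_walk a es y z : walk a es ->
  gact (gwalk a es) y z <-> y.1 = walk_end a es /\ z = (a, es ++ y.2).
Proof.
elim: es a z => [|e es IH] a z /=.
  by move=> _; rewrite gact_pi /=; case: y => b fs /=; split=> -[-> ->].
move=> [<- wes]; rewrite gactM; split.
  by move=> [x /IH-/(_ wes) [ye ->] /gact_pi [_ ->]].
move=> [ye ->]; exists (erng e, es ++ y.2); first exact/IH.
exact/gact_pi.
Qed.

Lemma gact_walkV a es y z : walk a es ->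
  gact (gwalkV a es) y z <-> gact (gwalk a es) z y.
Proof.
elim: es a y => [|e es IH] a y /=.
  by move=> _; rewrite !gact_pi /=; split=> -[? ->].
move=> [_ wes]; rewrite !gactM; split=> -[x].
  by move=> /gact_pi ? /IH-/(_ wes) ?; exists x => //; apply/gact_pi.
by move=> ? /gact_pi ?; exists x; [apply/gact_pi|apply/IH].
Qed.

Lemma gact_standard (u v : Defs.path E) y z : prng u = prng v ->
  gact (gpath u * gpathV v) y z <->
  exists es, y = (psrc v, pedges v ++ es) /\ z = (psrc u, pedges u ++ es).
Proof.
move=> uv; rewrite gactM; split=> [[x]|[es [-> ->]]].
  move=> /gact_walkV-/(_ (pwalk v)) /gact_walk-/(_ (pwalk v)) [_ ->].
  by move=> /gact_walk-/(_ (pwalk u)) [_ ->]; exists x.2.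
exists (prng u, es); last by apply/gact_walk => //; apply: pwalk.
by apply/gact_walkV; [|apply/gact_walk]; rewrite ?uv //; apply: pwalk.
Qed.

Lemma gact_standard_source (u v : Defs.path E) : prng u = prng v ->
  gact (gpath u * gpathV v) (psrc v, pedges v) (psrc u, pedges u).
Proof.
by move=> uv; apply/gact_standard => //; exists [::]; rewrite !cats0.
Qed.

Lemma standard_neq0 c (g : gis E) : standard_at c g -> g <> szero.
Proof.
move=> [u [v [uc vc ->]]] g0; have uv : prng u = prng v by rewrite vc.
by have := gact_standard_source uv; rewrite g0 => /gact_pi.
Qed.

(** The action of [u v^-1] is defined on [v] and on extensions of [v] only, and
    it sends [v] to [u]. *)
Lemma gact_faithful g h : (forall y z, gact g y z <-> gact h y z) -> g = h.
Proof.
have act_neq0 (k : gis E) c : standard_at c k -> exists y z, gact k y z.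
  move=> [u [v [uc vc ->]]]; have uv : prng u = prng v by rewrite vc.
  by exists (psrc v, pedges v), (psrc u, pedges u); apply: gact_standard_source.
have [->|[c cg]] := standard_form g; have [->|[d dh]] := standard_form h => //.
- by move=> gh; have [y [z /gh /gact_pi]] := act_neq0 _ _ dh.
- by move=> gh; have [y [z /gh /gact_pi]] := act_neq0 _ _ cg.
move: cg dh => [u [v [uc vc ->]]] [u' [v' [u'd v'd ->]]] gh.
have uv : prng u = prng v by rewrite vc.
have uv' : prng u' = prng v' by rewrite v'd.
have := gact_standard_source uv; rewrite gh gact_standard //.
move=> [es [[sv ev] [su eu]]].
have := gact_standard_source uv'; rewrite -gh gact_standard //.
move=> [fs [[_ ev'] _]].
(* [v] and [v'] are prefixes of each other *)
have es0 : es = [::].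
  apply: size0nil; have := congr1 size ev; rewrite {1}ev' !size_cat.
  by move=> /esym/eqP; rewrite -addnA -[X in _ == X]addn0 eqn_add2l addn_eq0
    => /andP[_ /eqP].
rewrite es0 !cats0 in ev eu.
by rewrite (path_ext su eu) (path_ext sv ev).
Qed.

End Action.

(** * J-classes and strongly connected components *)

Section JClassTheory.
Variable E : graph.
Implicit Types (a b c d : vertex E) (g h : gis E) (X Y : set (vertex E)).

Lemma gvertex_standard a c : standard_at c (gvertex a) -> c = a.
Proof.
move=> [u [v [uc vc E0]]]; have uv : prng u = prng v by rewrite vc.
(* The vertex [a] acts on the walk [a] without edges, hence [v] is that walk. *)
have : gact (gvertex a) (a, [::]) (a, [::]) by apply/gact_pi.
rewrite E0 => /gact_standard-/(_ uv) [es [[-> ev] _]].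
by rewrite -vc /prng; case: (pedges v) ev.
Qed.

Lemma mul_in_ideal (I : set (gis E)) g x y :
  two_sided_ideal I -> I g -> I (x * g * y).
Proof.
move=> [_ Il Ir] Ig; apply: Ir; exists (x * g); last by exists y.
by apply: Il; exists x => //; exists g.
Qed.

Lemma greenJI g h x y x' y' : h = x * g * y -> g = x' * h * y' -> greenJ g h.
Proof.
move=> hg gh; apply/seteqP; split=> k kI J [idJ Jg]; apply: kI; split=> // _ ->.
  by rewrite gh; apply: mul_in_ideal => //; apply: Jg.
by rewrite hg; apply: mul_in_ideal => //; apply: Jg.
Qed.

Lemma greenJ_ideal (I : set (gis E)) g h : two_sided_ideal I ->
  I h -> greenJ g h -> I g.
Proof.
move=> idI Ih gh; have : principal_ideal g g by move=> J [_]; apply.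
by rewrite gh; apply; split=> // _ ->.
Qed.

(** [c = u^-1 (u v^-1) v] and [u v^-1 = u c v^-1]. *)
Lemma standard_greenJ c g : standard_at c g -> greenJ g (gvertex c).
Proof.
move=> [u [v [uc vc ->]]].
apply: (@greenJI _ _ (gpathV u) (gpath v) (gpath u) (gpathV v)).
  by rewrite mulgA gpathVM -mulgA gpathVM uc vc gvertexM.
by rewrite -uc gpath_end.
Qed.

(** The elements lying below [gvertex b]: being an ideal, this set contains the
    principal ideal of [gvertex b], so that Green's relation can be turned into
    paths of the graph. *)
Definition below_ideal b : set (gis E) :=
  [set g | g = szero \/ exists2 c, standard_at c g & reach b c].

Lemma below_idealP b : two_sided_ideal (below_ideal b).
Proof.
split; first by exists szero; left.
- move=> _ [x _ [y [->|[d dy bd]] <-]]; first by left; rewrite muls0.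
  have [->|n0] := pselect (x * y = szero); first by left.
  have [x0|[c cx]] := standard_form x; first by rewrite x0 mul0s in n0.
  right; have [[dc ?]|[cd ?]] := standard_mul cx dy n0; last by exists d.
  by exists c => //; apply: reach_trans dc.
- move=> _ [x [->|[c cx bc]] [y _ <-]]; first by left; rewrite mul0s.
  have [->|n0] := pselect (x * y = szero); first by left.
  have [y0|[d dy]] := standard_form y; first by rewrite y0 muls0 in n0.
  right; have [[dc ?]|[cd ?]] := standard_mul cx dy n0; first by exists c.
  by exists d => //; apply: reach_trans cd.
Qed.

Lemma greenJ_reach a b : greenJ (gvertex a) (gvertex b) -> reach b a.
Proof.
have bb : below_ideal b (gvertex b).
  by right; exists b; [apply: standard_vertex|exists (pvertex b)].
move=> /(greenJ_ideal (below_idealP b) bb) [|[c /gvertex_standard ->]] //.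
by move/(standard_neq0 (standard_vertex a)).
Qed.

Lemma greenJ_vertex a b :
  greenJ (gvertex a) (gvertex b) -> strongly_connected a b.
Proof. by move=> ab; apply: reach_sc; apply: greenJ_reach. Qed.

Lemma component_sc X a b :
  components E X -> X a -> strongly_connected a b -> X b.
Proof. by move=> [c ->] /= ca ab; apply: strongly_connected_trans ab. Qed.

Lemma component_eq X Y a : components E X -> components E Y ->
  X a -> Y a -> X = Y.
Proof.
by move=> cX cY Xa Ya; apply: comp_le_anti => //; exists (pvertex a).
Qed.

(** A normal form generates the same ideal as its end vertex [c], so that the
    J-class of a vertex in [X] decides whether [c] is in [X]; zero is excluded
    because it is an ideal by itself, which contains no vertex. *)
Lemma JclassP X g : components E X ->
  Jclass X g <-> exists2 c, X c & standard_at c g.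
Proof.
move=> cX; split=> [[a Xa ga]|[c Xc cg]]; last first.
  by exists c => //; apply: standard_greenJ.
have [g0|[c cg]] := standard_form g; last first.
  exists c => //; apply: component_sc Xa _ => //; apply: greenJ_vertex.
  by rewrite /greenJ -ga; apply: standard_greenJ.
have id0 : two_sided_ideal [set szero : gis E].
  split; first by exists szero.
    by move=> _ [x _ [y -> <-]]; rewrite /= muls0.
  by move=> _ [x -> [y _ <-]]; rewrite /= mul0s.
case: (standard_neq0 (standard_vertex a)).
by apply: (greenJ_ideal id0 g0); rewrite /greenJ ga.
Qed.

Lemma comp_leI X Y a b : Y a -> X b -> reach a b -> comp_le X Y.
Proof. by move=> Ya Xb [u [ua ub]]; exists u; rewrite ua ub. Qed.

(** Common source of the two statements on products of classes: for comparable
    components antisymmetry tells which alternative holds, for incomparable ones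
    neither does. *)
Lemma Jclass0_mul X Y g h : components E X -> components E Y ->
  Jclass0 X g -> Jclass0 Y h -> g * h <> szero ->
  comp_le X Y /\ Jclass0 X (g * h) \/ comp_le Y X /\ Jclass0 Y (g * h).
Proof.
move=> cX cY [/(JclassP _ cX) [c Xc cg]|->]; last by rewrite mul0s.
move=> [/(JclassP _ cY) [d Yd dh]|->]; last by rewrite muls0.
move=> n0; have [[dc ?]|[cd ?]] := standard_mul cg dh n0; [left|right]; split.
- exact: comp_leI dc.
- by left; apply/JclassP => //; exists c.
- exact: comp_leI cd.
- by left; apply/JclassP => //; exists d.
Qed.

Lemma Jclass0M X g h : components E X ->
  Jclass0 X g -> Jclass0 X h -> Jclass0 X (g * h).
Proof.
move=> cX Xg Xh; have [->|n0] := pselect (g * h = szero); first by right.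
by have [[]|[]] := Jclass0_mul cX cX Xg Xh n0.
Qed.

Lemma component_convex X a b c : components E X -> X a -> X c ->
  reach a b -> reach b c -> X b.
Proof.
move=> cX Xa Xc ab bc; apply: (component_sc cX Xa); apply: reach_sc ab _.
apply: reach_trans bc _; exact: components_path Xc Xa.
Qed.

End JClassTheory.

(** * The inclusion of the semigroup of an induced subgraph *)

Section Inclusion.
Variables (E : graph) (X : set (vertex E)).
Local Notation EX := (induced_subgraph X).

Fixpoint gterm_incl (t : gterm EX) : gterm E :=
  match t with
  | GZero => GZero E
  | GVertex a => GVertex (val a)
  | GEdge e => GEdge (val e)
  | GInv e => GInv (val e)
  | GMul s t => GMul (gterm_incl s) (gterm_incl t)
  end.

Lemma gterm_incl_geq s t :
  Defs.geq s t -> Defs.geq (gterm_incl s) (gterm_incl t).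
Proof.
elim=> {s t} /=; try by constructor.
all: try (move=> e; first [exact: (geq_se (val e))|exact: (geq_er (val e))
  |exact: (geq_is (val e))|exact: (geq_ri (val e))|exact: (geq_ie (val e))]).
- by move=> s t r _ st _ tr; apply: geq_trans st tr.
- by move=> a b ab; apply: geq_vv0 => /val_inj.
- by move=> e f ef; apply: geq_ie0 => /val_inj.
Qed.

Definition gincl (g : gis EX) : gis E := \pi_(gis E) (gterm_incl (repr g)).

Lemma gincl_pi t : gincl (\pi_(gis EX) t) = \pi_(gis E) (gterm_incl t).
Proof. by apply/pi_gisP/gterm_incl_geq/pi_gisP; rewrite reprK. Qed.

Lemma ginclM g h : gincl (g * h) = gincl g * gincl h.
Proof. by rewrite -[g]reprK -[h]reprK gmulE !gincl_pi /= gmulE. Qed.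

Lemma gincl0 : gincl szero = szero.
Proof. exact: gincl_pi. Qed.

Lemma gincl_vertex a : gincl (gvertex a) = gvertex (val a).
Proof. exact: gincl_pi. Qed.

Lemma gincl_edge e : gincl (gedge e) = gedge (val e).
Proof. exact: gincl_pi. Qed.

Lemma gincl_edgeV e : gincl (gedgeV e) = gedgeV (val e).
Proof. exact: gincl_pi. Qed.

Definition walk_incl (y : vertex EX * seq (edge EX)) :
  vertex E * seq (edge E) := (val y.1, map val y.2).

Lemma walk_incl_inj : injective walk_incl.
Proof. by move=> [a es] [b fs] [/val_inj -> /(inj_map val_inj) ->]. Qed.

Lemma act_incl t y z : act (gterm_incl t) (walk_incl y) z <->
  exists2 x, act t y x & z = walk_incl x.
Proof.
elim: t y z => [|a|e|e|s IHs t IHt] [b es] z /=.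
- by split=> [|[]].
- split=> [[/val_inj -> ->]|[x [/= -> ->] ->]] //; by exists (a, es).
- split=> [[be ->]|[x [/= -> ->] ->]] //.
  exists (esrc e, e :: es) => //; split=> //; by apply: val_inj.
- split=> [[]|[x [xe [-> ->]] ->]]; last by rewrite /walk_incl xe.
  case: z => c fs /= -> [].
  case: es => // f es be /= [/val_inj fe <-]; subst f.
  exists (erng e, es) => //; split=> //; congr pair; by apply: val_inj.
- split=> [[x /IHt [x' tx ->] /IHs [z' sz ->]]|[x [y ty sx] ->]].
    by exists z' => //; exists x'.
  by exists (walk_incl y); [apply/IHt; exists y|apply/IHs; exists x].
Qed.

Lemma gact_incl g y z :
  gact g y z <-> gact (gincl g) (walk_incl y) (walk_incl z).
Proof.
split=> [gyz|/gact_pi/act_incl [x gyx /walk_incl_inj ->]] //.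
by apply/gact_pi/act_incl; exists z.
Qed.

(** An element of [gis EX] acts as its image in [gis E] does on the walks inside
    [X], and the action is faithful. *)
Lemma gincl_inj : injective gincl.
Proof.
by move=> g h gh; apply: gact_faithful => y z; rewrite !gact_incl gh.
Qed.

Hypothesis cX : components E X.

Lemma gincl_Jclass0 g : Jclass0 X (gincl g).
Proof.
have std c h : X c -> standard_at c h -> Jclass0 X h.
  by move=> Xc ch; left; apply/JclassP => //; exists c.
elim/gis_ind: g => [|a|e|e|g h Xg Xh].
- by right; rewrite gincl0.
- rewrite gincl_vertex; apply: std (standard_vertex _); exact: set_valP.
- rewrite gincl_edge; apply: std (standard_edge _); exact: (set_valP e).2.
- rewrite gincl_edgeV; apply: std (standard_edgeV _); exact: (set_valP e).2.
- by rewrite ginclM; apply: Jclass0M.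
Qed.

(** A walk between two vertices of a strongly connected component never leaves
    that component. *)
Lemma gwalk_incl a es : walk a es -> X a -> X (walk_end a es) ->
  exists g h, gincl g = gwalk a es /\ gincl h = gwalkV a es.
Proof.
elim: es a => [|e es IH] a /=.
  move=> _ Xa _; pose a' : vertex EX := SigSub (mem_set Xa).
  by exists (gvertex a'), (gvertex a'); rewrite gincl_vertex.
move=> [ea wes] Xa Xend.
have Xe : X (erng e).
  apply: (component_convex cX Xa Xend); first by exists (path_edge e).
  by exists (Path wes).
have [g [h [gE hE]]] := IH _ wes Xe Xend.
have Xse : X (esrc e) /\ X (erng e) by rewrite ea.
pose e' : edge EX := SigSub (mem_set Xse).
exists (gedge e' * g), (h * gedgeV e').
by rewrite !ginclM gincl_edge gincl_edgeV gE hE.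
Qed.

End Inclusion.

(** * The embedding of a J-class into a Brandt extension *)

Section Embedding.
Variables (E : graph) (X : set (vertex E)).
Hypothesis cX : components E X.
Local Notation EX := (induced_subgraph X).
Local Notation Q := (set_type (Q_paths X)).
Implicit Types (p q : Q) (es fs : seq (edge E)) (u v w : Defs.path E).

(** Stronger than membership in [Q_paths], which also admits walks of positive
    length that start in [X]; with them, a path could be cut in several ways,
    and one first half could be a prefix of another. *)
Fixpoint first_entry a es : Prop :=
  if es is e :: es' then ~ X a /\ first_entry (erng e) es' else X a.

Lemma first_entry_end a es : first_entry a es -> X (walk_end a es).
Proof. by elim: es a => //= e es IH a [_ /IH]. Qed.

Lemma first_entry_nil a es fs :
  first_entry a (es ++ fs) -> X (walk_end a es) -> fs = [::].
Proof.
elim: es a => [|e es IH] a /=; first by case: fs => //= e fs [].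
by move=> [_ /IH]; apply.
Qed.

Lemma first_entry_split a es : X (walk_end a es) ->
  exists fs gs, es = fs ++ gs /\ first_entry a fs.
Proof.
elim: es a => [|e es IH] a Xend; first by exists [::], [::].
have [Xa|nXa] := pselect (X a); first by exists [::], (e :: es).
by have [fs [gs [-> fe]]] := IH _ Xend; exists (e :: fs), gs.
Qed.

Lemma first_entry_prefix u v : X (prng u) -> first_entry (psrc v) (pedges v) ->
  Defs.prefix u v -> u = v.
Proof.
move=> Xu Hv [w [uw vE]]; move: Hv; rewrite vE /= => /first_entry_nil w0.
by apply: path_ext => //=; rewrite w0 // cats0.
Qed.

Lemma first_entry_Q u : first_entry (psrc u) (pedges u) -> Q_paths X u.
Proof.
move=> Hu; split=> [|v vu _ v_neq Xv]; first exact: first_entry_end.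
exact/v_neq/first_entry_prefix.
Qed.

Definition entry p := first_entry (psrc (val p)) (pedges (val p)).

Lemma entry_end p : X (prng (val p)).
Proof. by have [] := set_valP p. Qed.

(** If [p] were a proper prefix of [q], then [q] would meet [X] before its end. *)
Lemma gpathVM_entry p q : entry p -> entry q -> p <> q ->
  gpathV (val p) * gpath (val q) = szero.
Proof.
move=> Hp Hq pq; apply: contrapT => /gpathVM_comparable pre; apply/pq/val_inj.
case: pre => pre; last apply: esym;
  by apply: first_entry_prefix pre => //; apply: entry_end.
Qed.

Definition entry_vertex p : gis EX :=
  @gvertex EX (SigSub (mem_set (entry_end p))).

Lemma gincl_entry_vertex p : gincl (entry_vertex p) = gvertex (prng (val p)).
Proof. exact: gincl_vertex. Qed.

(** In these triples [(p, g, q)] the product of [p], [g] and the inverse of [q]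
    in [gis E] makes sense: [g] starts where [p] ends and ends where the
    inverse of [q] starts; [p] and [q] are first halves of cut paths. Those
    with [g] zero are kept, since products of non-zero triples may be of this
    form. *)
Definition composable : set (brandt Q (gis EX)) := [set t |
  if t is BrandtTriple p g q then
    [/\ entry p, entry q & entry_vertex p * g * entry_vertex q = g]
  else True].

Definition assemble (t : brandt Q (gis EX)) : gis E :=
  if t is BrandtTriple p g q then
    gpath (val p) * gincl g * gpathV (val q)
  else szero.

Lemma composableM s t : composable s -> composable t -> composable (s * t).
Proof.
case: s t => [|p g q] [|p' h q'] //= [Hp Hq gE] [Hp' Hq' hE].
rewrite [_ * _]/=/mul/=; case: asboolP => // _; split=> //.
have vv r : entry_vertex r * entry_vertex r = entry_vertex r.
  by rewrite gvertexM.
by rewrite -gE -hE !mulgA vv -!mulgA vv.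
Qed.

Lemma composable_vertexr p g q :
  composable (BrandtTriple p g q) -> g * entry_vertex q = g.
Proof. by move=> [_ _ <-]; rewrite -!mulgA gvertexM. Qed.

(** The middle factor [q^-1 p'] of a product of two assembled triples is the
    common end vertex if [q = p'] and zero otherwise. *)
Lemma assembleM s t : composable s -> composable t ->
  assemble (s * t) = assemble s * assemble t.
Proof.
case: s t => [|p g q] [|p' h q']; rewrite ?mul0s ?muls0 //.
move=> Cs Ct; have -> : BrandtTriple p g q * BrandtTriple p' h q' =
  if `[< q = p' >] then BrandtTriple p (g * h) q' else BrandtZero by [].
rewrite /= !mulgA -(mulgA _ (gpathV _) (gpath _)).
case: asboolP => [qp'|qp'] /=; last first.
  by rewrite gpathVM_entry ?muls0 ?mul0s //; [case: Cs|case: Ct].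
rewrite -qp' gpathVM -gincl_entry_vertex -(mulgA _ (gincl g)) -ginclM.
by rewrite (composable_vertexr Cs) ginclM mulgA.
Qed.

(** This and [assemble_middle_neq] make a triple with non-zero middle term
    recoverable from its image. *)
Lemma assemble_middle p g q : composable (BrandtTriple p g q) ->
  gpathV (val p) * assemble (BrandtTriple p g q) * gpath (val q) = gincl g.
Proof.
move=> [_ _ gE]; rewrite /= !mulgA gpathVM -(mulgA _ (gpathV _)) gpathVM.
by rewrite -!gincl_entry_vertex -!ginclM gE.
Qed.

Lemma assemble0 p g q : composable (BrandtTriple p g q) ->
  assemble (BrandtTriple p g q) = szero -> g = szero.
Proof.
move=> /assemble_middle + g0; rewrite g0 muls0 mul0s -(gincl0 X).
by move/gincl_inj.
Qed.

Lemma assemble_middle_neq p g q p' h q' :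
  composable (BrandtTriple p g q) -> composable (BrandtTriple p' h q') ->
  p <> p' \/ q <> q' ->
  gpathV (val p) * assemble (BrandtTriple p' h q') * gpath (val q) = szero.
Proof.
move=> [Hp Hq _] [Hp' Hq' _] /= [pp'|qq'].
  by rewrite !mulgA gpathVM_entry // !mul0s.
rewrite -mulgA -(mulgA _ _ (gpath _)) (gpathVM_entry Hq' Hq) ?muls0 //.
exact/nesym.
Qed.

Local Notation B0 := (brandt0 Q (gis EX)).

Definition brandt0_pi (t : brandt Q (gis EX)) : B0 := \pi_B0 t.

Lemma brandt0_piM s t : brandt0_pi (s * t) = brandt0_pi s * brandt0_pi t.
Proof. by symmetry; apply: rees_mulE. Qed.

(** Both sides say that [s] and [t] are equal or both represent zero. *)
Lemma brandt0_piP s t : composable s -> composable t ->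
  brandt0_pi s = brandt0_pi t <-> assemble s = assemble t.
Proof.
have pi0 r : composable r -> assemble r = szero ->
    brandt0_pi r = brandt0_pi BrandtZero.
  move=> Cr r0; apply/pi_reesP; right; split; last by left.
  case: r Cr r0 => [|p g q] Cr; first by left.
  by move=> /(assemble0 Cr) ->; right; exists p, q.
have assemble_zeros r : brandt_zeros r -> assemble r = szero.
  by move=> [->|[p [q ->]]] //=; rewrite gincl0 muls0 mul0s.
move=> Cs Ct; split.
  by move=> /pi_reesP [->//|[/assemble_zeros -> /assemble_zeros ->]].
case: s t Cs Ct => [|p g q] [|p' h q'] // Cs Ct st.
- by rewrite [RHS]pi0 // -st.
- by rewrite pi0.
have [[pp' qq']|neq] := pselect (p = p' /\ q = q').
  subst p' q'; have := assemble_middle Cs.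
  by rewrite st (assemble_middle Ct) => /gincl_inj ->.
have {}neq : p <> p' \/ q <> q'.
  by have [pp'|] := pselect (p = p'); [right=> qq'; apply: neq|left].
have := assemble_middle Cs; rewrite st (assemble_middle_neq Cs Ct neq).
rewrite -(gincl0 X) => /gincl_inj g0.
have s0 : assemble (BrandtTriple p g q) = szero.
  by rewrite /= -g0 gincl0 muls0 mul0s.
by rewrite !pi0 // -st.
Qed.

Lemma assemble_Jclass0 t : composable t -> Jclass0 X (assemble t).
Proof.
case: t => [|p g q] _ /=; first by right.
have std c h : X c -> standard_at c h -> Jclass0 X h.
  by move=> Xc ch; left; apply/JclassP => //; exists c.
apply: Jclass0M => //; last exact: std (entry_end q) (standard_pathV _).
apply: Jclass0M => //; last exact: gincl_Jclass0.
exact: std (entry_end p) (standard_path _).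
Qed.

(** After its first entry into [X], a path ending in [X] remains in [X]
    ([gwalk_incl]); the vertex of entry itself may be the source. *)
Lemma path_entry u : X (prng u) -> exists p (g h : gis EX),
  [/\ entry p, gpath u = gpath (val p) * gincl g &
      gpathV u = gincl h * gpathV (val p)].
Proof.
move=> Xu; have [fs [gs [uE Hfs]]] := first_entry_split Xu.
have wfs : walk (psrc u) fs /\ walk (walk_end (psrc u) fs) gs.
  have := pwalk u; rewrite uE; elim: fs (psrc u) {uE Hfs} => //= e fs IH a.
  by move=> [-> /IH []].
pose v := Path wfs.1; have Qv : Q_paths X v by apply: first_entry_Q.
have Xend : X (walk_end (prng v) gs).
  by move: Xu; rewrite /prng /walk_end uE map_cat last_cat.
have [g [h [gE hE]]] := gwalk_incl cX wfs.2 (first_entry_end Hfs) Xend.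
exists (SigSub (mem_set Qv)), g, h; split=> //.
  by rewrite /gpath uE gwalk_cat ?gE //; apply: wfs.2.
by rewrite /gpathV uE gwalkV_cat ?hE //; apply: wfs.2.
Qed.

Lemma assemble_onto g : Jclass0 X g ->
  exists2 t, composable t & assemble t = g.
Proof.
move=> [/(JclassP _ cX) [c Xc [u [v [uc vc ->]]]]|->].
  2: by exists BrandtZero.
have [|p [x [_ [Hp uE _]]]] := @path_entry u; first by rewrite uc.
have [|q [_ [y [Hq _ vE]]]] := @path_entry v; first by rewrite vc.
(* The vertices absorbed by [p] and [q] make the triple composable. *)
exists (BrandtTriple p (entry_vertex p * (x * y) * entry_vertex q) q).
  split=> //; rewrite !mulgA gvertexM -!mulgA.
  by rewrite [entry_vertex q * _]gvertexM.
rewrite /= !ginclM !gincl_entry_vertex uE vE !mulgA gpath_end.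
by rewrite -(mulgA _ (gvertex _)) gpathV_end.
Qed.

(** The isomorphism is the inverse of [assemble], which is well defined in the
    Rees quotient by [brandt0_piP]. *)
Lemma Jclass0_embedding : isom_to_subsemigroup B0 (Jclass0 X).
Proof.
exists (brandt0_pi @` composable); split.
- split; first by exists szero; right.
  by move=> _ [g Xg [h Xh <-]]; apply: Jclass0M.
- split; first by exists (brandt0_pi BrandtZero), BrandtZero.
  move=> _ [_ [s Cs <-] [_ [t Ct <-] <-]].
  by exists (s * t); [apply: composableM|rewrite brandt0_piM].
pose triple g := xget BrandtZero [set t | composable t /\ assemble t = g].
have tripleP g : Jclass0 X g ->
    composable (triple g) /\ assemble (triple g) = g.
  move=> /assemble_onto [t Ct tg].
  exact: (@xgetI _ BrandtZero [set t | composable t /\ assemble t = g] t).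
exists (brandt0_pi \o triple).
  split.
  - by move=> g /tripleP [Ct _]; exists (triple g).
  - move=> g h /set_mem /tripleP [Cg gE] /set_mem /tripleP [Ch hE].
    by move=> /(brandt0_piP Cg Ch); rewrite gE hE.
  - move=> _ [t Ct <-]; exists (assemble t); first exact: assemble_Jclass0.
    have [Cu uE] := tripleP _ (assemble_Jclass0 Ct).
    exact/brandt0_piP.
move=> g h /set_mem Xg /set_mem Xh /=; rewrite -brandt0_piM.
have [[Cg gE] [Ch hE]] := (tripleP _ Xg, tripleP _ Xh).
have [Cgh ghE] := tripleP _ (Jclass0M cX Xg Xh).
apply/brandt0_piP => //; first exact: composableM.
by rewrite ghE assembleM // gE hE.
Qed.

End Embedding.

Theorem theorem9 (E : graph) :
  [/\ (* the graph without vertices has G(E) = {0} but no component *)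
      [set: vertex E] !=set0 ->
        [set: gis E] = \bigcup_(X in components E) Jclass0 X,
      forall X, components E X ->
        isom_to_subsemigroup
          (brandt0 (set_type (Q_paths X)) (gis (induced_subgraph X)))
          (Jclass0 X),
      forall X Y, components E X -> components E Y -> X <> Y ->
        Jclass0 X `&` Jclass0 Y = [set szero],
      forall X Y, components E X -> components E Y -> comp_le X Y ->
        set_mul (Jclass0 X) (Jclass0 Y) `|` set_mul (Jclass0 Y) (Jclass0 X)
          `<=` Jclass0 X
    & forall X Y, components E X -> components E Y ->
        ~ comp_le X Y -> ~ comp_le Y X ->
        set_mul (Jclass0 X) (Jclass0 Y) `|` set_mul (Jclass0 Y) (Jclass0 X)
          `<=` [set szero]].
Proof.
have zero_in Z : Jclass0 Z (szero : gis E) by right.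
split.
- move=> [a0 _]; apply/seteqP; split=> // g _.
  have component_of a : components E [set b | strongly_connected a b].
    by exists a.
  have [->|[c cg]] := standard_form g.
    by exists [set b | strongly_connected a0 b].
  exists [set b | strongly_connected c b] => //; left; apply/JclassP => //.
  by exists c => //; apply: strongly_connected_refl.
- by move=> X cX; apply: Jclass0_embedding.
- move=> X Y cX cY XY; apply/seteqP; split=> [g [[Xg|//] [Yg|//]]|_ ->] //.
  case: Xg Yg => [a Xa ga] [b Yb gb]; case: XY.
  apply: (component_eq cX cY (a := b)) => //; apply: component_sc Xa _ => //.
  by apply: greenJ_vertex; rewrite /greenJ -ga gb.
- move=> X Y cX cY XY.
  have comp_eq : comp_le Y X -> X = Y by move=> YX; apply: comp_le_anti.
  move=> _ [] [g Zg [h Zh <-]];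
    (have [->//|n0] := pselect (g * h = szero));
    have := Jclass0_mul _ _ Zg Zh n0.
  + by move=> [//|//|[_ //]|[/comp_eq ->]].
  + by move=> [//|//|[/comp_eq ->]|[_ //]].
- move=> X Y cX cY nXY nYX _ [] [g Zg [h Zh <-]]; apply: contrapT => n0;
    by have [//|//|[]|[]] := Jclass0_mul _ _ Zg Zh n0.
Qed.
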